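(* Let $K \subset \mathbb{C}$ be a convex domain, let $n \geq 1$ and $m \geq 1$ be integers, and let $p:\mathbb{C} \rightarrow \mathbb{C}$ be a polynomial of degree $n+m$ whose roots (listed with multiplicity) are $a_1, \dots, a_{n+m}$, where $a_1, \dots, a_n \in K$ and $a_{n+1}, \dots, a_{n+m}$ lie outside $K$. Suppose that $$ \min_{n+1 \leq i \leq n+m}{ d(a_i, K)} \geq 2\,\mathrm{diam}(K) \sqrt{\frac{m^2}{n^2} + \frac{m}{n}}.$$ Then $p'$ has $n-1$ roots $z$ (counted with multiplicity) satisfying $$ d(z,K) \leq \frac{\mathrm{diam}(K) \sqrt{m}}{\sqrt{m+n}},$$ and its $m$ other roots $z$ satisfy $d(z,K) \geq \mathrm{diam}(K) \sqrt{m/(n+m)}$.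
   Context: For $z \in \mathbb{C}$ and a set $K \subset \mathbb{C}$, $d(z,K) = \inf_{w \in K}|z-w|$ denotes the distance from $z$ to $K$, and $\mathrm{diam}(K) = \sup_{w_1,w_2 \in K}|w_1-w_2|$ is the diameter of $K$. Roots are counted with multiplicity. *)

(* Defs.v *)
From HB Require Import structures.
From mathcomp Require Import all_boot all_order all_algebra.
From mathcomp Require Import complex.
From mathcomp Require Import all_classical all_reals.
Set Implicit Arguments. Unset Strict Implicit. Unset Printing Implicit Defensive.
Import Order.TTheory GRing.Theory Num.Theory.
Local Open Scope ring_scope.
Local Open Scope classical_set_scope.

Notation normc := ComplexField.Normc.normc.
(* The complex plane is modelled as R[i] for R : realType; the modulus is
   normc : R[i] -> R (= sqrt (Re z ^ 2 + Im z ^ 2)). *)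

Definition cdist (R : realType) (z : R[i]) (K : set R[i]) : R :=
  inf [set normc (z - w) | w in K].

Definition cdiam (R : realType) (K : set R[i]) : R :=
  sup [set normc (w1 - w2) | w1 in K & w2 in K].

Definition cconvex (R : realType) (K : set R[i]) : Prop :=
  forall x y, K x -> K y -> forall t : R, 0 <= t <= 1 ->
    K ((t%:C)%C * x + ((1 - t)%:C)%C * y).

Definition copen (R : realType) (K : set R[i]) : Prop :=
  forall z, K z -> exists2 e : R, 0 < e & forall w, normc (w - z) < e -> K w.

(* a convex domain: nonempty, open and convex (convex implies connected) *)
Definition convex_domain (R : realType) (K : set R[i]) : Prop :=
  K !=set0 /\ copen K /\ cconvex K.

Definition cbounded (R : realType) (K : set R[i]) : Prop :=
  exists M : R, forall w1 w2, K w1 -> K w2 -> normc (w1 - w2) <= M.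

(* Main.v *)
(* Write p = q r with q (resp. r) carrying the roots in (resp. outside) K, and
   consider P_t = q' r + t q r' for t in [0, 1], so that P_1 is p' up to the
   leading coefficient of p.  Put D = diam K and d = D sqrt (m / (n + m)).  If
   d(z, K) = d, projecting z on K gives |q'/q|(z) >= n d / (d^2 + D^2), while
   |r'/r|(z) <= m / (L - d) where L is the assumed lower bound on the distances
   of the outer roots; for this d the two bounds coincide, so P_t has no root
   on the level set d(z, K) = d when t < 1.  By compactness, the set of t for
   which P_t has k roots with d(z, K) <= d and the others with d(z, K) >= d is
   closed for each k; for t < 1 these sets partition [0, 1[, hence k is
   constant there, equal to n - 1 by Gauss-Lucas at t = 0, and closedness
   carries the splitting to t = 1.  *)
Require Import Defs.
From HB Require Import structures.
From mathcomp Require Import all_boot all_order all_algebra.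
From mathcomp Require Import complex.
From mathcomp Require Import all_classical all_reals.
From mathcomp Require Import topology normedtype.
From mathcomp Require Import ring lra.
Set Implicit Arguments. Unset Strict Implicit. Unset Printing Implicit Defensive.
Import Order.TTheory GRing.Theory Num.Theory.
Import numFieldNormedType.Exports.
Local Open Scope ring_scope.
Local Open Scope classical_set_scope.

(** Viewing [R[i]] as a normed module over itself gives it the topology of the modulus. The norm
    then takes values in [R[i]], whence the radii [e%:C] in the ball arguments. *)
HB.instance Definition _ (R : rcfType) := NormedModule.copy R[i] (R[i])^o.

(** * Modulus, distance to a set and diameter *)

Section Modulus.
Variable R : realType.
Implicit Types (x y z w : R[i]) (K : set R[i]).

Lemma normc_ge0 z : 0 <= normc z.
Proof. by case: z => a b; exact: sqrtr_ge0. Qed.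

Lemma normc_triangle x y : normc (x + y) <= normc x + normc y.
Proof. exact: (@le_normcD R). Qed.

Lemma normc_opp x : normc (- x) = normc x.
Proof. exact: (@normcN R). Qed.

Lemma normc_distC x y : normc (x - y) = normc (y - x).
Proof. by rewrite -normc_opp opprB. Qed.

Lemma sqr_normcE z : normc z ^+ 2 = complex.Re z ^+ 2 + complex.Im z ^+ 2.
Proof. by case: z => a b; rewrite /= sqr_sqrtr // addr_ge0 // sqr_ge0. Qed.

Lemma ler_sqr_normc z (r : R) : 0 <= r ->
  (normc z <= r) = (complex.Re z ^+ 2 + complex.Im z ^+ 2 <= r ^+ 2).
Proof. by move=> r0; rewrite -sqr_normcE ler_pXn2r // nnegrE normc_ge0. Qed.

Lemma normc_eq0 z : (normc z == 0) = (z == 0).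
Proof.
apply/eqP/eqP => [/ComplexField.Normc.eq0_normc //|->].
exact: ComplexField.Normc.normc0.
Qed.

Lemma Re_le_normc z : complex.Re z <= normc z.
Proof.
rewrite (le_trans (ler_norm _)) // -(@ler_pXn2r _ 2) ?nnegrE ?normc_ge0 //.
by rewrite sqr_normcE real_normK ?num_real // lerDl sqr_ge0.
Qed.

Lemma Im_le_normc z : `|complex.Im z| <= normc z.
Proof.
rewrite -(@ler_pXn2r _ 2) ?nnegrE ?normc_ge0 //.
by rewrite sqr_normcE real_normK ?num_real // lerDr sqr_ge0.
Qed.

Lemma absRe_le_normc z : `|complex.Re z| <= normc z.
Proof.
rewrite -(@ler_pXn2r _ 2) ?nnegrE ?normc_ge0 //.
by rewrite sqr_normcE real_normK ?num_real // lerDl sqr_ge0.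
Qed.

Lemma ltr_normcE z (r : R) : (`|z| < (r%:C)%C) = (normc z < r).
Proof. by rewrite -ltcR. Qed.

Lemma cdist_has_inf z K : K !=set0 -> has_inf [set normc (z - w) | w in K].
Proof.
case=> k Kk; split; first by exists (normc (z - k)), k.
by exists 0 => _ [w _ <-]; exact: normc_ge0.
Qed.

Lemma cdist_le K z w : K w -> cdist z K <= normc (z - w).
Proof.
move=> Kw; have K0 : K !=set0 by exists w.
by apply: ge_inf; [case: (cdist_has_inf z K0)|exists w].
Qed.

Lemma le_cdist K z (r : R) : K !=set0 ->
  (forall w, K w -> r <= normc (z - w)) -> r <= cdist z K.
Proof.
case=> k Kk rK; apply: lb_le_inf; first by exists (normc (z - k)), k.
by move=> _ [w Kw <-]; exact: rK.
Qed.

Lemma cdist_lt K z (r : R) : K !=set0 -> cdist z K < r ->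
  exists2 w, K w & normc (z - w) < r.
Proof.
move=> K0 zr; have := inf_lt (proj1 (cdist_has_inf z K0)) zr.
by case=> _ [w Kw <-] wr; exists w.
Qed.

Lemma cdist_lip K z w : K !=set0 -> cdist z K <= normc (z - w) + cdist w K.
Proof.
move=> K0; rewrite -lerBlDl; apply: le_cdist => // k Kk.
rewrite lerBlDr; apply: (le_trans (cdist_le z Kk)).
have -> : z - k = (w - k) + (z - w) by ring.
exact: normc_triangle.
Qed.

Lemma cdist_ge0 K z : K !=set0 -> 0 <= cdist z K.
Proof. by move=> K0; apply: le_cdist => // w _; exact: normc_ge0. Qed.

Lemma cdist_mem K z : K z -> cdist z K = 0.
Proof.
move=> Kz; apply/eqP; rewrite eq_le cdist_ge0 ?andbT; last by exists z.
by rewrite (le_trans (cdist_le z Kz)) // subrr ComplexField.Normc.normc0.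
Qed.

Lemma le_cdiam K x y : cbounded K -> K x -> K y -> normc (x - y) <= cdiam K.
Proof.
move=> [M KM] Kx Ky; apply: ub_le_sup; last by exists x => //; exists y.
by exists M => _ [u Ku [v Kv <-]]; exact: KM.
Qed.

(** Openness supplies a second point of [K], namely k + e/2, at distance e/2 from k. *)
Lemma cdiam_gt0 K : K !=set0 -> copen K -> cbounded K -> 0 < cdiam K.
Proof.
move=> [k Kk] oK bK; have [e e0 He] := oK k Kk.
have e20 : 0 < e / 2 by rewrite divr_gt0.
have nE : normc ((e / 2)%:C)%C = e / 2.
  by rewrite /= expr0n addr0 sqrtr_sqr gtr0_norm.
have := @le_cdiam K (k + ((e / 2)%:C)%C) k bK; rewrite addrC addrK nE.
move=> H; apply: lt_le_trans e20 (H _ Kk); apply: He.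
by rewrite addrK nE ltr_pdivrMr // mulr_natr mulr2n ltrDl.
Qed.

End Modulus.

(** * Weighted Gauss-Lucas, and a bound on one term of q'/q *)

Section LogarithmicDerivative.
Variable R : realType.
Implicit Types (z b v : R[i]) (K : set R[i]).

(** As 1/z = conj z / |z|^2, conjugation turns a vanishing sum of fractions l_i / (z - a_i) into a
    vanishing sum of vectors z - a_i with weights l_i / |z - a_i|^2. *)
Lemma conjc_frac (l : R) z :
  (((l%:C)%C / z)^*)%C = ((l / normc z ^+ 2)%:C)%C * z.
Proof.
rewrite sqr_normcE; case: z => x y; apply/eqP; rewrite eq_complex /=.
by apply/andP; split; apply/eqP; ring.
Qed.

(** Keeping the total weight as a factor avoids dividing by it, so the induction also passes through
    partial sums of weight zero. *)
Lemma cconvex_sum (I : Type) (r : seq I) (mu : I -> R) (a : I -> R[i]) K :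
  K !=set0 -> cconvex K -> (forall i, 0 <= mu i) -> (forall i, K (a i)) ->
  exists2 k, K k & \sum_(i <- r) ((mu i)%:C)%C * a i =
                   ((\sum_(i <- r) mu i)%:C)%C * k.
Proof.
move=> [k0 Kk0] cK mu0 Ka; elim: r => [|i r [k Kk IH]].
  by exists k0 => //; rewrite !big_nil mul0r.
rewrite !big_cons IH; set S := \sum_(j <- r) mu j.
have S0 : 0 <= S by apply: sumr_ge0.
have [T0|T0] := eqVneq (mu i + S) 0.
  have /eqP := T0; rewrite paddr_eq0 // => /andP[/eqP -> /eqP ->].
  by exists k0 => //; rewrite addr0 !mul0r addr0.
have Tp : 0 < mu i + S by rewrite lt_def T0 addr_ge0.
exists (((mu i / (mu i + S))%:C)%C * a i + ((1 - mu i / (mu i + S))%:C)%C * k).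
  apply: cK => //; rewrite divr_ge0 ?(ltW Tp) //= ler_pdivrMr // mul1r.
  by rewrite lerDl.
rewrite mulrDr !mulrA -!rmorphM /=; congr (_%:C%C * _ + _%:C%C * _).
  by rewrite mulrC divfK.
by rewrite mulrBr mulr1 mulrC divfK // addrC addKr.
Qed.

(** Conjugating the relation exhibits z as the barycentre of the a_i with weights [mu i]. Zero
    weights are allowed, so that the pencil can be treated at t = 0 as well. *)
Lemma weighted_gauss_lucas (I : finType) (l : I -> R) (a : I -> R[i]) K z :
  cconvex K -> (forall i, 0 <= l i) -> 0 < \sum_i l i ->
  (forall i, K (a i)) -> (forall i, z != a i) ->
  \sum_i ((l i)%:C)%C / (z - a i) = 0 -> K z.
Proof.
move=> cK l0 lp Ka za Hz.
pose mu i := l i / normc (z - a i) ^+ 2.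
have mu0 i : 0 <= mu i by rewrite divr_ge0 // sqr_ge0.
have [i0 li0] : exists i, 0 < l i.
  apply/not_existsP => H; move: lp; rewrite big1 ?ltxx // => i _.
  by apply/eqP; rewrite eq_le l0 andbT leNgt; apply/negP.
have sp : 0 < \sum_i mu i.
  rewrite (bigD1 i0) //= ltr_pwDl // ?sumr_ge0 // divr_gt0 // exprn_gt0 //.
  by rewrite lt_def normc_ge0 normc_eq0 subr_eq0 za.
have [k Kk Hk] := @cconvex_sum I (index_enum I) mu a K (ex_intro _ _ (Ka i0)) cK mu0 Ka.
have E : \sum_i ((mu i)%:C)%C * (z - a i) = 0.
  have := congr1 (@conjc R) Hz; rewrite (rmorph_sum (@conjc R)) conjc0.
  move=> H; rewrite -[RHS]H; apply: eq_bigr => i _.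
  exact: esym (conjc_frac _ _).
suff -> : z = k by [].
have : ((\sum_i mu i)%:C)%C * z = ((\sum_i mu i)%:C)%C * k.
  rewrite -Hk; apply/eqP; rewrite -subr_eq0 rmorph_sum mulr_suml -sumrB.
  by apply/eqP; rewrite -[RHS]E; apply: eq_bigr => i _; rewrite mulrBr.
by apply: mulfI; rewrite eq_complex /= eqxx andbT gt_eqF.
Qed.

(** Used with b = z - k and v = k - a_i, for k almost nearest to z in K. With B = |b|^2, V = |v|^2
    and c the scalar product of b and v, the real part is (B + c) / (B + 2c + V); [e] measures how
    far c >= 0 may fail. *)
Lemma Re_frac_shift_ge b v (d D e : R) :
  0 < d -> d <= D -> 0 <= e -> d <= normc b -> normc v <= D ->
  d <= normc (b + v) ->
  - e <= complex.Re b * complex.Re v + complex.Im b * complex.Im v ->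
  d ^+ 2 / (d ^+ 2 + D ^+ 2) - e * (D ^+ 2 / ((d ^+ 2 + D ^+ 2) * d ^+ 2))
    <= complex.Re (b / (b + v)).
Proof.
move=> d0 dD e0.
have D0 : 0 < D by exact: lt_le_trans dD.
have sq x : d <= normc x -> d ^+ 2 <= complex.Re x ^+ 2 + complex.Im x ^+ 2.
  by move=> h; rewrite -sqr_normcE ler_pXn2r // nnegrE ?ltW ?(lt_le_trans d0).
move=> /sq + + /sq; rewrite ler_sqr_normc ?(ltW D0) //.
case: b => b1 b2; case: v => v1 v2 /= hb hv hw hc.
set W := (b1 + v1) ^+ 2 + (b2 + v2) ^+ 2 in hw *.
have d20 : 0 < d ^+ 2 by rewrite exprn_gt0.
have D20 : 0 < D ^+ 2 by rewrite exprn_gt0.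
have dD2 : d ^+ 2 <= D ^+ 2 by rewrite ler_pXn2r // nnegrE ltW.
have W0 : 0 < W by exact: lt_le_trans hw.
have -> : b1 * ((b1 + v1) / W) - b2 * (- ((b2 + v2) / W)) =
   (b1 ^+ 2 + b2 ^+ 2 + (b1 * v1 + b2 * v2)) / W by field; rewrite gt_eqF.
have WE : W = b1 ^+ 2 + b2 ^+ 2 + 2 * (b1 * v1 + b2 * v2) + (v1 ^+ 2 + v2 ^+ 2).
  by rewrite /W; ring.
set c := b1 * v1 + b2 * v2 in hc WE *.
set B := b1 ^+ 2 + b2 ^+ 2 in hb WE *.
set V := v1 ^+ 2 + v2 ^+ 2 in hv WE.
set d2 := d ^+ 2 in hb d20 dD2 hw *; set D2 := D ^+ 2 in hv D20 dD2 *.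
have E0 : 0 < d2 + D2 by rewrite addr_gt0.
rewrite -subr_ge0.
have -> : (B + c) / W - (d2 / (d2 + D2) - e * (D2 / ((d2 + D2) * d2))) =
  ((B + c) * (d2 + D2) - d2 * W + e * D2 + e * D2 * (W - d2) / d2) / (W * (d2 + D2)).
  by field; rewrite !gt_eqF.
apply: divr_ge0; last by rewrite mulr_ge0 // ltW.
apply: addr_ge0; last first.
  by rewrite divr_ge0 ?(ltW d20) // mulr_ge0 ?subr_ge0 // mulr_ge0 // ltW.
rewrite WE.
(* Each summand on the right is nonnegative, by B >= d^2, c >= -e, d <= D and V <= D^2. *)
have -> : (B + c) * (d2 + D2) - d2 * (B + 2 * c + V) + e * D2 =
  (B - d2) * D2 + (c + e) * (D2 - d2) + d2 * (D2 - V) + e * d2 by ring.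
by rewrite !addr_ge0 // mulr_ge0 ?subr_ge0 // ?(ltW D20) ?(ltW d20) // -lerBlDr sub0r.
Qed.

End LogarithmicDerivative.

(** * Lower bound for |q'/q| at distance d from K *)

Section LowerBound.
Variable R : realType.
Implicit Types (z : R[i]) (K : set R[i]).

(* An almost nearest point [k] of [K] makes an almost non-acute angle with
   [K]: otherwise a small step from [k] towards [x] would come closer to [z]
   than [cdist z K]. *)
Lemma almost_projection K z (d D e : R) :
  cconvex K -> (forall x y, K x -> K y -> normc (x - y) <= D) ->
  K !=set0 -> cdist z K = d -> 0 < d -> 0 < e <= 1 ->
  exists2 k, K k & normc (z - k) <= d + e /\
    forall x, K x -> - (e * (1 + D ^+ 2)) <=
      complex.Re (z - k) * complex.Re (k - x) +
      complex.Im (z - k) * complex.Im (k - x).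
Proof.
move=> cK KD K0 zd d0 /andP[e0 e1].
(* The squared distance to k will exceed d^2 by at most e^2, so that division by the step length e
   leaves an error of order e. *)
have s0 : d < Num.sqrt (d ^+ 2 + e ^+ 2).
  rewrite -(@ltr_pXn2r _ 2) ?nnegrE ?sqrtr_ge0 ?(ltW d0) //.
  by rewrite sqr_sqrtr ?addr_ge0 ?sqr_ge0 // ltrDl exprn_gt0.
have [|k Kk zk] := @cdist_lt R K z (Num.sqrt (d ^+ 2 + e ^+ 2)) K0.
  by rewrite zd.
have zk2 : normc (z - k) ^+ 2 <= d ^+ 2 + e ^+ 2.
  rewrite -(@sqr_sqrtr _ (d ^+ 2 + e ^+ 2)) ?addr_ge0 ?sqr_ge0 //.
  by rewrite ler_pXn2r ?nnegrE ?normc_ge0 ?sqrtr_ge0 // ltW.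
exists k => //; split.
  rewrite -(@ler_pXn2r _ 2) ?nnegrE ?normc_ge0 ?addr_ge0 ?(ltW d0) ?(ltW e0) //.
  by apply: (le_trans zk2); nra.
move=> x Kx.
have e01 : 0 <= e <= 1 by rewrite ltW.
have : d <= normc (z - (((e%:C)%C) * x + (((1 - e)%:C)%C) * k)).
  by rewrite -zd; apply: cdist_le; exact: cK.
have := KD _ _ Kk Kx.
have D0 : 0 <= D by apply: le_trans (KD _ _ Kk Kk); exact: normc_ge0.
rewrite ler_sqr_normc // -[d <= _](@ler_pXn2r _ 2) ?nnegrE ?normc_ge0 ?(ltW d0) //.
rewrite sqr_normcE; move: zk2; rewrite sqr_normcE.
case: z {zd zk} => z1 z2; case: k {Kk} => k1 k2; case: x {Kx} => x1 x2 /=.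
rewrite !mul0r !subr0 !addr0 => h1 h2 h3.
set c := (z1 - k1) * (k1 - x1) + (z2 - k2) * (k2 - x2).
set V := (k1 - x1) ^+ 2 + (k2 - x2) ^+ 2 in h2.
set B := (z1 - k1) ^+ 2 + (z2 - k2) ^+ 2 in h1.
have {}h3 : d ^+ 2 <= B + 2 * e * c + e ^+ 2 * V.
  by apply: le_trans h3 _; rewrite le_eqVlt /B /c /V; apply/orP; left; apply/eqP; ring.
have {h1 h3}h4 : 0 <= e * (e + 2 * c + e * V) by nra.
have {h4}h4 : 0 <= e + 2 * c + e * V by rewrite pmulr_rge0 in h4.
have h5 : e * V <= e * D ^+ 2 by rewrite ler_pM2l.
have h6 : 0 <= e * D ^+ 2 by rewrite mulr_ge0 ?sqr_ge0 ?(ltW e0).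
by rewrite -/c; lra.
Qed.

(** Multiplied by z - k, with k almost nearest to z, every term of the sum has real part at least
    d^2 / (d^2 + D^2) up to O(e), while |z - k| <= d + e. A nearest point may be missing from K, so
    the bound is obtained by letting e tend to 0. *)
Lemma normc_sum_inv_ge (I : finType) (a : I -> R[i]) K z (d D : R) :
  cconvex K -> (forall x y, K x -> K y -> normc (x - y) <= D) ->
  K !=set0 -> (forall i, K (a i)) -> cdist z K = d -> 0 < d -> d <= D ->
  #|I|%:R * (d / (d ^+ 2 + D ^+ 2)) <= normc (\sum_i (z - a i)^-1).
Proof.
move=> cK KD K0 Ka zd d0 dD; set S := \sum_i _.
pose N : R := #|I|%:R.
have D0 : 0 < D by exact: lt_le_trans dD.
(* [e * C] is the loss in [Re_frac_shift_ge] when its error term is [e * (1 + D ^+ 2)]. *)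
pose C := (1 + D ^+ 2) * (D ^+ 2 / ((d ^+ 2 + D ^+ 2) * d ^+ 2)).
have C0 : 0 <= C.
  have dd : 0 <= d ^+ 2 by exact: sqr_ge0.
  have DD : 0 <= D ^+ 2 by exact: sqr_ge0.
  apply: mulr_ge0; first exact: addr_ge0.
  by apply: divr_ge0 => //; apply: mulr_ge0 => //; exact: addr_ge0.
have key e : 0 < e <= 1 ->
    N * (d ^+ 2 / (d ^+ 2 + D ^+ 2)) <= d * normc S + e * (normc S + N * C).
  move=> /[dup] e01 /andP[e0 e1].
  have [k Kk [zk kx]] := almost_projection cK KD K0 zd d0 e01.
  have T i : d ^+ 2 / (d ^+ 2 + D ^+ 2) - e * C <= complex.Re ((z - k) / (z - a i)).
    have zE : z - a i = (z - k) + (k - a i) by ring.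
    rewrite zE /C [e * (_ * _)]mulrA; apply: Re_frac_shift_ge => //.
    - by rewrite mulr_ge0 ?(ltW e0) ?addr_ge0 ?sqr_ge0.
    - by rewrite -zd; exact: cdist_le.
    - exact: KD.
    - by rewrite -zE -zd; exact: cdist_le.
    - exact: kx.
  have : N * (d ^+ 2 / (d ^+ 2 + D ^+ 2) - e * C) <= complex.Re ((z - k) * S).
    rewrite mulr_sumr (raddf_sum (@complex.Re R : Rcomplex R -> R)).
    rewrite mulr_natl -sumr_const; apply: ler_sum => i _; exact: T.
  move=> /le_trans/(_ (Re_le_normc _)); rewrite ComplexField.Normc.normcM.
  have : normc (z - k) * normc S <= (d + e) * normc S.
    by rewrite ler_wpM2r // normc_ge0.
  rewrite -/N; set X := d ^+ 2 / _; lra.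
have : N * (d ^+ 2 / (d ^+ 2 + D ^+ 2)) <= d * normc S.
  apply/ler_addgt0Pr => e e0.
  (* The summand 1 makes [M] positive; the parameter min(1, e / M) is admissible in [key] and costs
     at most e. *)
  pose M := normc S + N * C + 1.
  have M0 : 0 < M by rewrite ltr_wpDl // addr_ge0 ?normc_ge0 // mulr_ge0.
  have := key (Num.min 1 (e / M)).
  rewrite lt_min ltr01 divr_gt0 //= ge_min lexx => /(_ isT) /le_trans; apply.
  rewrite lerD2l; apply: (@le_trans _ _ (e / M * (normc S + N * C))).
    by rewrite ler_wpM2r ?ge_min ?lexx ?orbT // addr_ge0 ?normc_ge0 // mulr_ge0.
  rewrite -mulrA ler_piMr ?(ltW e0) // mulrC ler_pdivrMr // mul1r.
  by rewrite /M lerDl.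
move=> H; rewrite -(ler_pM2l d0).
suff -> : d * (#|I|%:R * (d / (d ^+ 2 + D ^+ 2))) =
          N * (d ^+ 2 / (d ^+ 2 + D ^+ 2)) by [].
by rewrite expr2; ring.
Qed.

End LowerBound.

(* The first [k] and the last [l] roots may both lie on the level set [f = d]:
   with these weak inequalities the splitting is a closed condition. *)
Definition root_split (R : realType) (f : R[i] -> R) (d : R) (k l : nat)
    (p : {poly R[i]}) : Prop :=
  exists s1 s2 : seq R[i],
    [/\ size s1 = k, size s2 = l,
        p = lead_coef p *: \prod_(z <- s1 ++ s2) ('X - z%:P),
        (forall z, z \in s1 -> f z <= d) & (forall z, z \in s2 -> d <= f z)].

(** * Counting roots on either side of a level *)

Section RootSplit.
Variables (R : realType) (f : R[i] -> R) (d : R).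
Implicit Types (p : {poly R[i]}) (k l : nat).

(** Indexing the roots by an ordinal makes them a point of a product space, ready for Tychonoff's
    theorem. *)
Lemma root_splitP k l p :
  root_split f d k l p <->
  exists z : 'I_(k + l) -> R[i],
    [/\ p = lead_coef p *: \prod_i ('X - (z i)%:P),
        forall j, f (z (lshift l j)) <= d & forall j, d <= f (z (rshift k j))].
Proof.
split=> [[s1 [s2 [e1 e2 pE s1d s2d]]]|[z [pE zl zr]]].
  exists (fun i => nth 0 (s1 ++ s2) i); split.
  - rewrite {1}pE; congr (_ *: _).
    by rewrite (big_nth 0) big_mkord size_cat e1 e2.
  - by move=> j; apply: s1d; rewrite nth_cat e1 /= ltn_ord mem_nth // e1.
  - move=> j; apply: s2d; rewrite nth_cat e1 /= ltnNge leq_addr /= addKn.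
    by rewrite mem_nth // e2.
exists (codom (z \o @lshift k l)), (codom (z \o @rshift k l)); split.
- by rewrite size_codom card_ord.
- by rewrite size_codom card_ord.
- by rewrite {1}pE big_cat /= !big_image big_split_ord.
- by move=> _ /codomP[j ->]; exact: zl.
- by move=> _ /codomP[j ->]; exact: zr.
Qed.

Lemma root_split_exists p : p != 0 ->
  exists k l, (k + l = (size p).-1)%N /\ root_split f d k l p.
Proof.
move=> p0; have [r pE] := closed_field_poly_normal p.
have sr : size r = (size p).-1.
  by rewrite pE size_scale ?lead_coef_eq0 // size_prod_XsubC.
pose P z := f z <= d.
exists (size [seq z <- r | P z]), (size [seq z <- r | ~~ P z]); split.
  by rewrite !size_filter count_predC.
exists [seq z <- r | P z], [seq z <- r | ~~ P z]; split => //.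
- rewrite {1}pE; congr (_ *: _); apply: perm_big; rewrite perm_sym.
  exact: permEl (perm_filterC P r).
- by move=> z; rewrite mem_filter => /andP[].
- by move=> z; rewrite mem_filter /= -ltNge => /andP[/ltW].
Qed.

(** With no root on the level, k is the number of roots with f z <= d, which depends only on the
    multiset of roots determined by p. *)
Lemma root_split_inj k l k' l' p : p != 0 ->
  (forall z, f z = d -> ~~ root p z) ->
  root_split f d k l p -> root_split f d k' l' p -> k = k'.
Proof.
move=> p0 pd; have lp0 : lead_coef p != 0 by rewrite lead_coef_eq0.
have cnt a b s1 s2 : size s1 = a -> size s2 = b ->
    p = lead_coef p *: \prod_(z <- s1 ++ s2) ('X - z%:P) ->
    (forall z, z \in s1 -> f z <= d) -> (forall z, z \in s2 -> d <= f z) ->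
    count (fun z => f z <= d) (s1 ++ s2) = a.
  move=> <- _ pE h1 h2; rewrite count_cat.
  have -> : count (fun z => f z <= d) s1 = size s1.
    by apply/eqP; rewrite -all_count; apply/allP.
  suff -> : count (fun z => f z <= d) s2 = 0%N by rewrite addn0.
  apply/eqP; rewrite -leqn0 leqNgt -has_count; apply/hasPn => z zs2.
  rewrite -ltNge lt_neqAle h2 // andbT eq_sym; apply/negP => /eqP/pd/negP; apply.
  by rewrite pE rootZ // root_prod_XsubC mem_cat zs2 orbT.
move=> [s1 [s2 [e1 e2 pE h1 h2]]] [r1 [r2 [g1 g2 pF i1 i2]]].
rewrite -(cnt k l s1 s2) // -(cnt k' l' r1 r2) //; apply/permP.
apply: prod_XsubC_eq; apply: (scalerI lp0).
by rewrite -pE -pF.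
Qed.

End RootSplit.

(** * Compactness in the plane and closedness of root splittings *)

Section ComplexTopology.
Variable R : realType.

Lemma lipschitz_continuous (f : R[i] -> R) :
  (forall z w, f z <= normc (z - w) + f w) -> continuous f.
Proof.
move=> fL z; apply/(@cvgrPdist_lt R R _ (nbhs z) (nbhs_filter z)) => e e0.
apply/nbhs_ballP; exists (e%:C)%C => [|w]; first by rewrite /= ltcR.
rewrite -ball_normE /= ltr_normcE.
have := fL z w; have := fL w z; rewrite (normc_distC w z) ltr_norml.
by move=> h1 h2 h3; apply/andP; split; lra.
Qed.

Lemma continuous_normc : continuous (@normc R).
Proof.
apply: lipschitz_continuous => z w.
by rewrite -{1}[z](subrK w) normc_triangle.
Qed.

Lemma continuous_real_complex : continuous (fun t : R => (t%:C)%C : R[i]).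
Proof.
move=> t; apply/(@cvgrPdist_lt R[i] R[i] _ (nbhs t) (nbhs_filter t)).
move=> -[e e'] /=; rewrite ltcE /= => /andP[/eqP -> e0].
apply/nbhs_ballP; exists e => //= s; rewrite /ball /= => ts.
by rewrite -rmorphB -[(e +i* 0)%C]/((e%:C)%C) ltr_normcE /= expr0n addr0 sqrtr_sqr.
Qed.

Lemma continuous_Complex :
  continuous (fun x : R * R => (x.1%:C)%C + 'i%C * (x.2%:C)%C : R[i]).
Proof.
move=> x; apply: cvgD.
  by apply: (cvg_comp _ _ cvg_fst); exact: continuous_real_complex.
apply: cvgM; first exact: cvg_cst.
by apply: (cvg_comp _ _ cvg_snd); exact: continuous_real_complex.
Qed.

(** The disk is a closed subset of the image of a square under (x, y) -> x + iy. *)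
Lemma compact_disk (M : R) : compact [set z : R[i] | normc z <= M].
Proof.
pose g (x : R * R) : R[i] := (x.1%:C)%C + 'i%C * (x.2%:C)%C.
have Kc : compact (g @` (`[- M, M] `*` `[- M, M])).
  apply: continuous_compact; last by apply: compact_setX; exact: segment_compact.
  by apply: continuous_subspaceT; exact: continuous_Complex.
apply: (subclosed_compact _ Kc).
  apply: (@preimage_closed _ _ (@normc R) [set x | x <= M]).
    by move=> z _; exact: continuous_normc.
  exact: closed_le.
move=> z /= zM; exists (complex.Re z, complex.Im z); last first.
  by rewrite /g [RHS]complexE.
by split; rewrite /= in_itv /= -ler_norml (le_trans _ zM) //
  (absRe_le_normc, Im_le_normc).
Qed.

Lemma poly_eq_horner (p q : {poly R[i]}) : (forall w, p.[w] = q.[w]) -> p = q.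
Proof.
move=> pq; apply/eqP; rewrite -subr_eq0; apply/negPn/negP => /closed_nonrootP.
by case=> x; rewrite rootE hornerD hornerN pq subrr eqxx.
Qed.

(** The set is the projection to the t-axis of a compact set of pairs (t, roots). The affine formula
    for the leading coefficient makes the factorisation an equation continuous in both, and the
    bound M confines the roots to a compact disk. *)
Lemma closed_root_split (f : R[i] -> R) (d M u v : R) (k l : nat)
    (U V : {poly R[i]}) :
  continuous f ->
  (forall t, 0 <= t <= 1 ->
     lead_coef (U + (t%:C)%C *: V) = ((u + t * v)%:C)%C) ->
  (forall t z, 0 <= t <= 1 -> root (U + (t%:C)%C *: V) z -> normc z <= M) ->
  closed [set t | 0 <= t <= 1 /\ root_split f d k l (U + (t%:C)%C *: V)].
Proof.
move=> cf lE rM; pose X := (R * {ptws 'I_(k + l) -> R[i]})%type.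
have c1 : continuous (fun x : X => (x.1%:C)%C : R[i]).
  by move=> x; apply: (cvg_comp _ _ cvg_fst); exact: continuous_real_complex.
have cpr i : continuous (fun x : X => x.2 i : R[i]).
  move=> x; apply: (@continuous_comp _ {ptws 'I_(k + l) -> R[i]} _ snd
    (fun z : {ptws 'I_(k + l) -> R[i]} => z i : R[i])); first exact: cvg_snd.
  exact: (@proj_continuous _ (fun _ : 'I_(k + l) => R[i] : topologicalType) i).
(* The vanishing of [E w] for all w expresses the factorisation, pointwise in w. *)
pose E w (x : X) : R[i] := U.[w] + (x.1%:C)%C * V.[w] -
   ((u%:C)%C + (x.1%:C)%C * (v%:C)%C) * \prod_i (w - x.2 i).
have cE w : continuous (E w).
  move=> x; apply: (@cvgB R[i] R[i] X (nbhs x) (nbhs_filter x)).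
    apply: cvgD; first exact: cvg_cst.
    by apply: cvgM; [exact: c1|exact: cvg_cst].
  apply: cvgM.
    apply: cvgD; first exact: cvg_cst.
    by apply: cvgM; [exact: c1|exact: cvg_cst].
  apply: cvg_big => [y|i _].
    by apply: cvgM; [exact: cvg_fst|exact: cvg_snd].
  by apply: cvgB; [exact: cvg_cst|exact: cpr].
pose S : set X := (`[0, 1] `*` [set z | forall i, normc (z i) <= M]) `&`
  (\bigcap_(w in setT) (E w @^-1` [set 0]) `&`
  (\bigcap_(j in setT) ((fun x => f (x.2 (lshift l j))) @^-1` [set y | y <= d]) `&`
   \bigcap_(j in setT) ((fun x => f (x.2 (rshift k j))) @^-1` [set y | d <= y]))).
have -> : [set t | 0 <= t <= 1 /\ root_split f d k l (U + (t%:C)%C *: V)] =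
    fst @` S.
  apply/seteqP; split=> [t [t01 /root_splitP[z [pE zl zr]]]|
                         _ [[t z] [[t01 _] [zE [zl zr]]] <-]] /=.
    exists (t, z) => //; split; last split; last split.
    - split; first by rewrite /= in_itv.
      move=> i; apply: (rM t) => //; rewrite pE rootE hornerZ horner_prod.
      by rewrite (bigD1 i) //= hornerXsubC subrr mul0r mulr0.
    - move=> w _ /=; have := congr1 (fun p => p.[w]) pE.
      rewrite lE // hornerD !hornerZ horner_prod /E /= => ->.
      rewrite rmorphD rmorphM /=; apply/eqP; rewrite subr_eq0; apply/eqP.
      by congr (_ * _); apply: eq_bigr => i _; rewrite hornerXsubC.
    - by move=> j _; exact: zl.
    - by move=> j _; exact: zr.
  have {}t01 : 0 <= t <= 1 by move: t01; rewrite /= in_itv.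
  split=> //; apply/root_splitP; exists z; split.
  - rewrite lE //; apply: poly_eq_horner => w; have /eqP := zE w I.
    rewrite /E /= subr_eq0 => /eqP; rewrite hornerD !hornerZ horner_prod => ->.
    rewrite rmorphD rmorphM /=.
    by congr (_ * _); apply: eq_bigr => i _; rewrite hornerXsubC.
  - by move=> j; exact: zl.
  - by move=> j; exact: zr.
apply: compact_closed; first exact: norm_hausdorff.
apply: continuous_compact.
  by apply: continuous_subspaceT => x; exact: cvg_fst.
apply: compact_closedI.
  apply: compact_setX; first exact: segment_compact.
  exact: (@tychonoff 'I_(k + l) (fun=> R[i]) (fun=> [set z | normc z <= M])
    (fun=> @compact_disk M)).
apply: closedI; last apply: closedI.
- apply: closed_bigI => w _; apply: preimage_closed; last first.
    exact: accessible_closed_set1 (hausdorff_accessible (@norm_hausdorff _ _)) _.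
  by move=> x _; exact: cE.
- apply: closed_bigI => j _; apply: preimage_closed; last exact: closed_le.
  by move=> x _; apply: (cvg_comp _ _ (cpr _ x)); exact: cf.
- apply: closed_bigI => j _; apply: preimage_closed; last exact: closed_ge.
  by move=> x _; apply: (cvg_comp _ _ (cpr _ x)); exact: cf.
Qed.

End ComplexTopology.

(** * Connectedness of [0, 1[ *)

(** On [0, 1[ the set [T k] is closed and its complement is a finite union of closed sets, so
    connectedness forces it to be everything. The point 1, where the sets may overlap, is reached as
    a limit. *)
Lemma closed_partition_itv (R : realType) (T : nat -> set R) (N k : nat) :
  (forall c, closed (T c)) ->
  (forall t, 0 <= t < 1 -> exists2 c, (c <= N)%N & T c t) ->
  (forall t c c', 0 <= t < 1 -> T c t -> T c' t -> c = c') ->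
  T k 0 -> T k 1.
Proof.
move=> clT coverT injT Tk0.
pose A : set R := [set t | 0 <= t < 1].
have cA : connected A.
  apply/connected_intervalP => x y /andP[x0 _] /andP[_ y1] z /andP[xz zy].
  by rewrite /A /= (le_trans x0 xz) (le_lt_trans zy y1).
have kA : A `&` T k = A.
  apply: cA; last by exists (T k).
    by exists 0; split => //; rewrite /A /= lexx ltr01.
  (* The bound N makes this union finite, hence closed, and its complement open. *)
  exists (~` \bigcup_(c in [set c | (c < N.+1)%N /\ c != k]) T c).
    apply: closed_openC; apply: closed_bigcup => //.
    by apply: (sub_finite_set _ (finite_II N.+1)) => c [].
  apply/seteqP; split => t [At tT]; split=> //.
    by move=> [c [_ ck] ct]; move: ck; rewrite (injT t c k) ?eqxx.
  have [c cN ct] := coverT t At; have [<-//|ck] := eqVneq c k.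
  by exfalso; apply: tT; exists c.
apply: clT => B /nbhs_ballP[e /= e0 eB].
(* The point 1 - h lies in [0, 1[ and within e of 1. *)
pose h : R := Num.min (e / 2) (1 / 2).
have h0 : 0 < h by rewrite lt_min !divr_gt0.
have he : h < e by rewrite gt_min ltr_pdivrMr // mulr_natr mulr2n ltrDl e0.
have h1 : h <= 1 / 2 by rewrite ge_min lexx orbT.
have hA : A (1 - h) by rewrite /A /=; apply/andP; split; lra.
exists (1 - h); split; first by move: hA; rewrite -[in X in X -> _]kA => -[].
by apply: eB; rewrite -ball_normE /= opprB addrC subrK gtr0_norm.
Qed.

(** * The pencil q' r + t q r' and its roots for t in [0, 1] *)

Section Pencil.
Variable R : realType.
Implicit Types (z : R[i]) (K : set R[i]).

Lemma deriv_prod_XsubC (I : Type) (s : seq I) (a : I -> R[i]) z :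
  (forall i, z != a i) ->
  (\prod_(i <- s) ('X - (a i)%:P))^`().[z] =
  (\prod_(i <- s) ('X - (a i)%:P)).[z] * \sum_(i <- s) (z - a i)^-1.
Proof.
move=> za; elim: s => [|i s IH]; first by rewrite !big_nil derivC horner0 mulr0.
rewrite !big_cons derivM derivXsubC mul1r hornerD !hornerM IH hornerXsubC.
have : z - a i != 0 by rewrite subr_eq0.
by move=> zi; field.
Qed.

Lemma horner_prod_XsubC_neq0 (n : nat) (a : 'I_n -> R[i]) z :
  (forall i, z != a i) -> (\prod_(j < n) ('X - (a j)%:P)).[z] != 0.
Proof.
by move=> za; rewrite horner_prod; apply/prodf_neq0 => i _;
  rewrite hornerXsubC subr_eq0.
Qed.

Lemma poly_splits (p : {poly R[i]}) (k : nat) (c : R[i]) :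
  (size p <= k.+1)%N -> p`_k = c -> c != 0 ->
  exists2 s : seq R[i], size s = k & p = c *: \prod_(x <- s) ('X - x%:P).
Proof.
move=> sp pk c0; have sE : size p = k.+1.
  apply/eqP; rewrite eqn_leq sp ltnNge; apply: contra c0 => sk.
  by rewrite -pk nth_default.
have lE : lead_coef p = c by rewrite lead_coefE sE.
have [s ps] := closed_field_poly_normal p; rewrite lE in ps.
exists s => //; have := sE.
by rewrite ps size_scale // size_prod_XsubC => -[].
Qed.

Lemma deriv_prod_splits (n : nat) (a : 'I_n.+1 -> R[i]) :
  exists2 s : seq R[i], size s = n &
    (\prod_i ('X - (a i)%:P))^`() = n.+1%:R *: \prod_(x <- s) ('X - x%:P).
Proof.
have sq : size (\prod_i ('X - (a i)%:P)) = n.+2.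
  by rewrite size_prod_XsubC /index_enum -enumT size_enum_ord.
apply: poly_splits; last by rewrite pnatr_eq0.
  rewrite -ltnS -sq lt_size_deriv // -size_poly_eq0 sq //.
rewrite coef_deriv; have /monicP := monic_prod_XsubC (index_enum 'I_n.+1) predT a.
by rewrite lead_coefE sq /= => ->.
Qed.

Variables (n m : nat) (a : 'I_n.+1 -> R[i]) (b : 'I_m.+1 -> R[i]).
Let q := \prod_i ('X - (a i)%:P).
Let r := \prod_i ('X - (b i)%:P).

(** There are [n.+1] inner roots [a] and [m.+1] outer roots [b], so that q' has exactly [n]
    roots. *)
Definition pencil (t : R) : {poly R[i]} :=
  q^`() * r + (t%:C)%C *: (q * r^`()).

Lemma pencil1 : pencil 1 = (q * r)^`().
Proof. by rewrite /pencil scale1r derivM. Qed.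

Lemma horner_pencil t z : (forall i, z != a i) -> (forall j, z != b j) ->
  (pencil t).[z] = q.[z] * r.[z] *
    (\sum_i (z - a i)^-1 + (t%:C)%C * \sum_j (z - b j)^-1).
Proof.
move=> za zb; rewrite /pencil hornerD hornerZ !hornerM !deriv_prod_XsubC //.
by rewrite -/q -/r; ring.
Qed.

(** Both q' r and q r' have degree n + m + 1 and positive leading coefficients, so the degree does
    not drop for t >= 0 and the leading coefficient is affine in t, as [closed_root_split]
    requires. *)
Lemma size_lead_coef_pencil t : 0 <= t ->
  size (pencil t) = (n + m).+2 /\
  lead_coef (pencil t) = ((n.+1%:R + t * m.+1%:R)%:C)%C.
Proof.
move=> t0; have [s sn qE] := deriv_prod_splits a.
have [s' sm rE] := deriv_prod_splits b.
rewrite -/q in qE; rewrite -/r in rE.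
have qs : q = \prod_(x <- codom a) ('X - x%:P) by rewrite big_image.
have rs : r = \prod_(x <- codom b) ('X - x%:P) by rewrite big_image.
have UE : q^`() * r = n.+1%:R *: \prod_(x <- s ++ codom b) ('X - x%:P).
  by rewrite qE rs big_cat /= scalerAl.
have VE : q * r^`() = m.+1%:R *: \prod_(x <- codom a ++ s') ('X - x%:P).
  by rewrite rE qs big_cat /= scalerAr.
have sU : size (\prod_(x <- s ++ codom b) ('X - x%:P)) = (n + m).+2.
  by rewrite size_prod_XsubC size_cat size_codom card_ord sn addnS.
have sV : size (\prod_(x <- codom a ++ s') ('X - x%:P)) = (n + m).+2.
  by rewrite size_prod_XsubC size_cat size_codom card_ord sm addSn.
have cU : (\prod_(x <- s ++ codom b) ('X - x%:P))`_(n + m).+1 = 1.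
  have /monicP := monic_prod_XsubC (s ++ codom b) predT id.
  by rewrite lead_coefE sU.
have cV : (\prod_(x <- codom a ++ s') ('X - x%:P))`_(n + m).+1 = 1.
  have /monicP := monic_prod_XsubC (codom a ++ s') predT id.
  by rewrite lead_coefE sV.
have pE : (pencil t)`_(n + m).+1 = ((n.+1%:R + t * m.+1%:R)%:C)%C.
  rewrite /pencil UE VE coefD !coefZ cU cV !mulr1.
  by rewrite rmorphD rmorphM /= !rmorph_nat.
have p0 : ((n.+1%:R + t * m.+1%:R)%:C)%C != 0 :> R[i].
  rewrite eq_complex /= eqxx andbT gt_eqF // ltr_pwDl ?ltr0n //.
  by rewrite mulr_ge0.
have sp : size (pencil t) = (n + m).+2.
  apply/eqP; rewrite eqn_leq; apply/andP; split.
    rewrite /pencil UE VE (leq_trans (size_polyD _ _)) // geq_max.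
    by rewrite !(leq_trans (size_scale_leq _ _)) ?sU ?sV.
  by rewrite ltnNge; apply: contra p0 => sk; rewrite -pE nth_default.
by split=> //; rewrite lead_coefE sp.
Qed.

(** Away from the roots of q r, dividing by q r leaves a relation between the fractions 1/(z - a_i)
    with weight 1 and 1/(z - b_j) with weight t, to which weighted Gauss-Lucas applies. *)
Lemma root_pencil_convex t z K : cconvex K -> 0 <= t ->
  (forall i, K (a i)) -> (forall j, K (b j)) ->
  (forall j, z != b j) -> root (pencil t) z -> K z.
Proof.
move=> cK t0 Ka Kb zb pz.
have [/existsP[i /eqP ->]//|] := boolP [exists i, z == a i].
rewrite negb_exists => /forallP za.
move: pz; rewrite rootE horner_pencil // !mulf_eq0.
rewrite !(negPf (horner_prod_XsubC_neq0 _)) //= => /eqP H.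
pose c (i : 'I_n.+1 + 'I_m.+1) := match i with inl i => a i | inr j => b j end.
pose l (i : 'I_n.+1 + 'I_m.+1) : R := match i with inl i => 1 | inr j => t end.
apply: (@weighted_gauss_lucas R _ l c K z) => //.
- by case.
- rewrite big_sumType /= ltr_pwDl ?sumr_const ?card_ord ?ltr0n //.
  by rewrite mulrn_wge0.
- by case=> [i|j] /=; [exact: Ka|exact: Kb].
- by case.
- rewrite big_sumType /= -[RHS]H; congr (_ + _).
    by apply: eq_bigr => i _; rewrite mul1r.
  by rewrite mulr_sumr.
Qed.

(** A disk about 0 containing all roots of q r is convex, hence holds the roots of the pencil; its
    radius does not depend on t. *)
Lemma root_pencil_bounded t z : 0 <= t -> root (pencil t) z ->
  normc z <= \sum_i normc (a i) + \sum_j normc (b j).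
Proof.
move=> t0 pz; set M := _ + _.
have aM i : normc (a i) <= M.
  rewrite /M (bigD1 i) //= -addrA lerDl.
  by apply: addr_ge0; apply: sumr_ge0 => *; exact: normc_ge0.
have bM j : normc (b j) <= M.
  rewrite /M [X in _ + X](bigD1 j) //= addrCA lerDl.
  by apply: addr_ge0; apply: sumr_ge0 => *; exact: normc_ge0.
have [/existsP[j /eqP ->]//|] := boolP [exists j, z == b j].
rewrite negb_exists => /forallP zb.
apply: (@root_pencil_convex t z [set w | normc w <= M]) => //.
move=> x y /= xM yM u /andP[u0 u1].
apply: (le_trans (normc_triangle _ _)).
rewrite !ComplexField.Normc.normcM /= !expr0n !addr0 !sqrtr_sqr.
rewrite !ger0_norm ?subr_ge0 //.
have h1 : u * normc x <= u * M by rewrite ler_wpM2l.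
have h2 : (1 - u) * normc y <= (1 - u) * M by rewrite ler_wpM2l ?subr_ge0.
lra.
Qed.

(** A root would equate the moduli of the sum of the 1/(z - a_i) and of t times the sum of the 1/(z
    - b_j). The first is at least [m.+1%:R / (L - d)], the second at most t times that, and t <
    1. *)
Lemma pencil_level_neq0 K (d D L t : R) z :
  cconvex K -> (forall x y, K x -> K y -> normc (x - y) <= D) ->
  (forall i, K (a i)) -> (forall j, L <= cdist (b j) K) ->
  0 < d -> d <= D -> d < L ->
  m.+1%:R / (L - d) <= n.+1%:R * (d / (d ^+ 2 + D ^+ 2)) ->
  0 <= t < 1 -> cdist z K = d -> ~~ root (pencil t) z.
Proof.
move=> cK KD Ka Lb d0 dD dL mn /andP[t0 t1] zd.
have K0 : K !=set0 by exists (a ord0).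
have za i : z != a i.
  by apply: contraTneq d0 => zi; rewrite -zd zi cdist_mem ?ltxx.
(* The distance to K is 1-Lipschitz; it equals d at z and is at least L at b_j. *)
have zbL j : L - d <= normc (z - b j).
  rewrite lerBlDr -zd normc_distC; apply: le_trans (Lb j) _.
  exact: cdist_lip.
have zb j : z != b j.
  have : 0 < normc (z - b j) by apply: lt_le_trans (zbL j); rewrite subr_gt0.
  by rewrite lt_def normc_eq0 subr_eq0 => /andP[].
rewrite rootE horner_pencil // !mulf_neq0 ?horner_prod_XsubC_neq0 //.
rewrite addr_eq0; apply/eqP => H.
have h1 := normc_sum_inv_ge cK KD K0 Ka zd d0 dD.
have h2 : normc (\sum_j (z - b j)^-1) <= m.+1%:R / (L - d).
  apply: (@le_trans _ _ (\sum_j normc ((z - b j)^-1))).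
    elim/big_ind2 : _ => [|x1 y1 x2 y2 xy1 xy2|//].
      by rewrite ComplexField.Normc.normc0.
    by apply: le_trans (normc_triangle _ _) _; exact: lerD.
  apply: (@le_trans _ _ (\sum_(j < m.+1) (L - d)^-1)); last first.
    by rewrite sumr_const card_ord mulr_natl.
  apply: ler_sum => j _; rewrite ComplexField.Normc.normcV lef_pV2 ?posrE ?subr_gt0 //.
  by apply: lt_le_trans (zbL j); rewrite subr_gt0.
move: h1; rewrite card_ord H normc_opp ComplexField.Normc.normcM /= expr0n addr0.
rewrite sqrtr_sqr ger0_norm // => h1.
have h3 : t * normc (\sum_j (z - b j)^-1) <= t * (m.+1%:R / (L - d)).
  by rewrite ler_wpM2l.
have h4 : 0 < m.+1%:R / (L - d) by rewrite divr_gt0 ?ltr0n ?subr_gt0.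
have : m.+1%:R / (L - d) <= t * (m.+1%:R / (L - d)).
  by apply: le_trans h3; apply: le_trans h1.
by rewrite leNgt gtr_pMl // t1.
Qed.

(** The pencil starts at q' r: Gauss-Lucas puts the roots of q' in K, at distance 0, and the other
    roots are the b_j. *)
Lemma pencil0_split K (d : R) :
  cconvex K -> 0 <= d -> (forall i, K (a i)) -> (forall j, d <= cdist (b j) K) ->
  root_split (fun z => cdist z K) d n m.+1 (pencil 0).
Proof.
move=> cK d0 Ka bK; have [s sn qE] := deriv_prod_splits a.
exists s, (codom b); split => //.
- by rewrite size_codom card_ord.
- have [_ ->] := @size_lead_coef_pencil 0 (lexx _).
  rewrite mul0r addr0 rmorph_nat /pencil scale0r addr0 qE big_cat /= scalerAl.
  by rewrite big_image.
- move=> z zs; rewrite cdist_mem //.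
  have qz : root q^`() z by rewrite qE rootZ ?pnatr_eq0 // root_prod_XsubC.
  have [/existsP[i /eqP ->]//|] := boolP [exists i, z == a i].
  rewrite negb_exists => /forallP za.
  move: qz; rewrite rootE deriv_prod_XsubC // mulf_eq0.
  rewrite (negPf (horner_prod_XsubC_neq0 za)) /= => /eqP H.
  apply: (@weighted_gauss_lucas R _ (fun=> 1) a K z) => //.
    by rewrite sumr_const card_ord ltr0n.
  by rewrite -[RHS]H; apply: eq_bigr => i _; rewrite mul1r.
- by move=> _ /codomP[j ->].
Qed.

Lemma pencil1_split K (d D L : R) :
  cconvex K -> (forall x y, K x -> K y -> normc (x - y) <= D) ->
  (forall i, K (a i)) -> (forall j, L <= cdist (b j) K) ->
  0 < d -> d <= D -> d < L ->
  m.+1%:R / (L - d) <= n.+1%:R * (d / (d ^+ 2 + D ^+ 2)) ->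
  root_split (fun z => cdist z K) d n m.+1 (pencil 1).
Proof.
move=> cK KD Ka Lb d0 dD dL mn.
have K0 : K !=set0 by exists (a ord0).
pose N := (n + m.+1)%N.
(* [N] is the degree of the pencil for t >= 0; for c > N the truncated [N - c] leaves [T c]
   empty. *)
pose T c := [set t : R | 0 <= t <= 1 /\
  root_split (fun z => cdist z K) d c (N - c) (pencil t)].
suff : T n 1 by rewrite /T /= /N addKn => -[].
have p0 t : 0 <= t -> pencil t != 0.
  by move=> t0; rewrite -size_poly_eq0 (proj1 (size_lead_coef_pencil t0)).
apply: (@closed_partition_itv R T N n).
- move=> c; apply: (@closed_root_split R _ d
     (\sum_i normc (a i) + \sum_j normc (b j)) n.+1%:R m.+1%:R).
  + by apply: lipschitz_continuous => z w; exact: cdist_lip.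
  + by move=> t /andP[t0 _]; exact: (proj2 (size_lead_coef_pencil t0)).
  + by move=> t z /andP[t0 _]; exact: root_pencil_bounded.
- move=> t /andP[t0 t1].
  have [k [l [kl kP]]] := root_split_exists (fun z => cdist z K) d (p0 t t0).
  move: kl; rewrite (proj1 (size_lead_coef_pencil t0)) /= -addnS -/N => kl.
  exists k; first by rewrite -kl leq_addr.
  by split; [rewrite t0 ltW|rewrite -kl addKn].
- move=> t c c' t01 [_ cP] [_ cP']; have /andP[t0 _] := t01.
  apply: (root_split_inj (p0 t t0) _ cP cP') => z.
  exact: (pencil_level_neq0 cK KD Ka Lb).
- split; first by rewrite lexx ler01.
  rewrite /N addKn; apply: pencil0_split => //; first exact: ltW.
  by move=> j; apply: le_trans (Lb j); exact: ltW.
Qed.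

End Pencil.

(** * The choice of constants and the conclusion *)

(** Taken at x = n and y = m. One finds L = 2 d (x + y) / x and d^2 + D^2 = D^2 (x + 2y) / (x + y),
    and the last inequality is in fact an equality, which explains the choice of d for this L. *)
Lemma level_constants (R : realType) (x y D : R) : 0 < x -> 0 < y -> 0 < D ->
  let d := D * Num.sqrt (y / (x + y)) in
  let L := 2 * D * Num.sqrt ((y / x) ^+ 2 + y / x) in
  [/\ 0 < d, d <= D, d < L & y / (L - d) <= x * (d / (d ^+ 2 + D ^+ 2))].
Proof.
move=> x0 y0 D0 d L; pose s := Num.sqrt (y / (x + y)).
have xy0 : 0 < x + y by rewrite addr_gt0.
have xyy0 : 0 < x + 2 * y by rewrite addr_gt0 // mulr_gt0.
have s0 : 0 < s by rewrite sqrtr_gt0 divr_gt0.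
have s2 : s ^+ 2 = y / (x + y) by rewrite sqr_sqrtr // divr_ge0 // ltW.
have d0 : 0 < d by rewrite mulr_gt0.
have d2 : d ^+ 2 = D ^+ 2 * (y / (x + y)) by rewrite exprMn -/s s2.
have LE : L = 2 * d * (x + y) / x.
  rewrite /L; have -> : (y / x) ^+ 2 + y / x = (s * ((x + y) / x)) ^+ 2.
    by rewrite [RHS]exprMn s2; field; rewrite ?(gt_eqF x0) ?(gt_eqF xy0).
  rewrite sqrtr_sqr ger0_norm ?mulr_ge0 ?invr_ge0 ?(ltW s0) ?(ltW x0) ?(ltW xy0) //.
  by rewrite /d -/s; ring.
have LdE : L - d = d * (x + 2 * y) / x by rewrite LE; field; rewrite gt_eqF.
split=> //.
- rewrite /d ger_pMr // -(@ler_pXn2r _ 2) ?nnegrE ?(ltW s0) // s2 expr1n.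
  by rewrite ler_pdivrMr // mul1r lerDr ltW.
- by rewrite -subr_gt0 LdE divr_gt0 // mulr_gt0.
- rewrite LdE le_eqVlt; apply/orP; left; apply/eqP.
  have -> : x * (d / (d ^+ 2 + D ^+ 2)) = x * (x + y) * d / (D ^+ 2 * (x + 2 * y)).
    have -> : d ^+ 2 + D ^+ 2 = D ^+ 2 * (x + 2 * y) / (x + y).
      by rewrite d2; field; rewrite (gt_eqF xy0).
    by field; rewrite ?(gt_eqF xyy0) ?(gt_eqF xy0) ?(gt_eqF D0).
  (* Expanding by d puts d in the denominator, as on the left-hand side, and d^2, whose value is
     known, in the numerator. *)
  have -> : x * (x + y) * d / (D ^+ 2 * (x + 2 * y)) =
            x * (x + y) * d ^+ 2 / (d * D ^+ 2 * (x + 2 * y)).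
    by field; rewrite ?(gt_eqF xyy0) ?(gt_eqF d0) ?(gt_eqF D0).
  rewrite d2; field.
  by rewrite ?(gt_eqF x0) ?(gt_eqF xyy0) ?(gt_eqF xy0) ?(gt_eqF d0) ?(gt_eqF D0).
Qed.

Theorem theorem2 (R : realType) (K : set R[i]) (n m : nat)
  (p : {poly R[i]}) (a : 'I_(n + m) -> R[i]) :
  convex_domain K -> cbounded K ->
  (0 < n)%N -> (0 < m)%N ->
  size p = (n + m).+1 ->
  p = lead_coef p *: \prod_(i < n + m) ('X - (a i)%:P) ->
  (forall i : 'I_(n + m), (i < n)%N -> K (a i)) ->
  (forall i : 'I_(n + m), (n <= i)%N -> ~ K (a i)) ->
  (forall i : 'I_(n + m), (n <= i)%N ->
     2 * cdiam K * Num.sqrt ((m%:R / n%:R) ^+ 2 + m%:R / n%:R) <= cdist (a i) K) ->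
  exists s1 s2 : seq R[i],
    [/\ size s1 = (n - 1)%N, size s2 = m,
        p^`() = lead_coef p^`() *: \prod_(z <- s1 ++ s2) ('X - z%:P),
        (forall z, z \in s1 ->
           cdist z K <= cdiam K * Num.sqrt m%:R / Num.sqrt (m + n)%:R) &
        (forall z, z \in s2 ->
           cdiam K * Num.sqrt (m%:R / (n + m)%:R) <= cdist z K)].
Proof.
move=> [K0 [oK cK]] bK.
(* With both counts written as successors, n - 1 becomes the [n] of the pencil. *)
case: n a => [//|n] a _; case: m a => [//|m] a _ _ pE Ka _ La.
have D0 := cdiam_gt0 K0 oK bK.
have [] := @level_constants R n.+1%:R m.+1%:R _ (ltr0Sn _ _) (ltr0Sn _ _) D0.
rewrite -!natrD; set d := cdiam K * _; set L := _ * Num.sqrt _ => d0 dD dL mn.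
(* The two bounds in the conclusion are the same number d, written differently. *)
have -> : cdiam K * Num.sqrt m.+1%:R / Num.sqrt (m.+1 + n.+1)%:R = d.
  by rewrite /d sqrtrM // sqrtrV // mulrA addnC.
have [] := @pencil1_split R n m (fun i => a (lshift m.+1 i))
  (fun j => a (rshift n.+1 j)) K d (cdiam K) L cK
  (fun u v => @le_cdiam R K u v bK) _ _ d0 dD dL mn.
- by move=> i; apply: Ka; exact: (ltn_ord i).
- by move=> j; apply: La; rewrite /= leq_addr.
rewrite subSS subn0 => s1 [s2 [e1 e2 PE h1 h2]]; exists s1, s2; split=> //.
set P := pencil _ _ _ in PE.
(* p' is the pencil at t = 1 up to a constant factor, so the splitting carries over with the same
   roots. *)
have -> : p^`() = lead_coef p *: P.
  by rewrite {1}pE big_split_ord /= derivZ /P pencil1.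
by rewrite lead_coefZ -scalerA -PE.
Qed.
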